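(* For every $x \in (0,\pi]$, $$\frac{1}{180}x^5 < x - \frac{3\sin x}{2+\cos x} \le \frac{1}{m_1}x^5,$$ where $m_1 = 1/f(t_0) = 92.96406\ldots$ is the constant determined by the function $f(t)=\dfrac{t-\frac{3\sin t}{2+\cos t}}{t^5}$ and the point $t_0=2.83982\ldots$, the unique solution in $(0,\pi)$ of the equation $$\frac{30\sin t+15\cos t\sin t}{4\cos^2 t+22\cos t+19}=t .$$
   Context: The numerical expressions with dots (such as $92.96406\ldots$) denote the initial decimal digits of the constants concerned. The value $M_1=f(t_0)=0.010756\ldots$ is the maximum of $f$ on $(0,\pi)$, and $m_1=1/M_1$. *)

(* Defs.v *)
From Stdlib Require Import Reals.
Open Scope R_scope.

(* The function f; [Reals] already exports a projection named [f]. *)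
Definition fq (t : R) : R := (t - 3 * sin t / (2 + cos t)) / t ^ 5.

(* The denominator is at least 1 since 4c^2 + 22c + 19 increases on [-1, 1]. *)
Definition t0_equation (t : R) : Prop :=
  (30 * sin t + 15 * cos t * sin t)
    / (4 * (cos t) ^ 2 + 22 * cos t + 19) = t.

(* Main.v *)
Require Import Defs.
From Stdlib Require Import Reals ZArith Lra Psatz.
From Coquelicot Require Import Coquelicot.
Open Scope R_scope.

(** Write s, c for the sine and cosine at t, and D(c) = 4c^2 + 22c + 19 for the
    denominator in the equation defining t0, which is positive on [-1, 1].  Let
    gap(t) = (30s + 15cs) / D(c) - t be the difference of its two sides.

    Differentiating the quotient f gives f'(t) = gap(t) * D(c) / ((2+c)^2 t^6)
    ([fq_derive]), so f moves according to the sign of gap.  The derivative of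
    gap factors as 2 (1-c)^3 (8c+7) / D(c)^2 ([gap_derive]).  As c decreases on
    [0, PI], gap starts from gap(0) = 0, increases while c > -7/8, and decreases
    afterwards; so it has at most one zero t0 in (0, PI), is positive before t0
    and negative after it ([gap_sign]).  Hence f is maximal at t0 ([fq_max]),
    which is the upper inequality.

    For the lower inequality, the difference x - 3 sin x/(2 + cos x) - x^5/180
    vanishes at 0 and has derivative ((1-c)/(2+c))^2 - (t^2/6)^2.  That this is
    positive becomes, in the half angle y = t/2, the bound
    3 y^2 < (sin y)^2 (3 + 2 y^2), which follows from a Taylor polynomial of the
    sine ([sin_sq_lower]).

    The decimals come from enclosures of sine and cosine at 2.83982 and 2.83983,
    obtained from Taylor polynomials at the half angles.  The intermediate value
    theorem locates t0 between these two points.  Since t0 is a maximum,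
    f(2.83982) is a lower bound for f(t0); it is also within 1e-10 of f(t0),
    because f' is small on the whole interval: gap is decreasing there and
    already below 1e-4 at its left end ([fq_growth]). *)

(** * Taylor enclosures of sine and cosine *)

(** The factorial in binary integers: evaluating [fact n] itself builds a unary
    numeral, which is out of the question for n = 15. *)
Fixpoint Zfact (n : nat) : Z :=
  match n with O => 1 | S p => Z.of_nat (S p) * Zfact p end.

Lemma INR_fact n : INR (fact n) = IZR (Zfact n).
Proof.
  induction n as [|n IH]; [reflexivity|].
  rewrite fact_simpl, mult_INR, IH, INR_IZR_INZ, <- mult_IZR. reflexivity.
Qed.

Ltac eval_factorials :=
  rewrite !INR_fact;
  repeat match goal with |- context [Zfact ?n] =>
    let v := eval vm_compute in (Zfact n) in change (Zfact n) with v
  end.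

Lemma sin_ge_taylor7 a : 0 <= a <= 4 ->
  a * (1 - a ^ 2 / 6 + (a ^ 2) ^ 2 / 120 - (a ^ 2) ^ 3 / 5040) <= sin a.
Proof.
  intros [H0 H4]. destruct (pre_sin_bound a 1 H0 H4) as [H _].
  eapply Rle_trans; [|exact H]. apply Req_le.
  unfold sin_approx, sin_term. cbn [Nat.mul Nat.add sum_f_R0].
  eval_factorials. field.
Qed.

Lemma sin_taylor_bounds a : 0 <= a <= 4 ->
  a - a ^ 3 / 6 + a ^ 5 / 120 - a ^ 7 / 5040 + a ^ 9 / 362880
    - a ^ 11 / 39916800 + a ^ 13 / 6227020800 - a ^ 15 / 1307674368000
  <= sin a <=
  a - a ^ 3 / 6 + a ^ 5 / 120 - a ^ 7 / 5040 + a ^ 9 / 362880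
    - a ^ 11 / 39916800 + a ^ 13 / 6227020800.
Proof.
  intros [H0 H4].
  destruct (pre_sin_bound a 3 H0 H4) as [H _].
  destruct (pre_sin_bound a 2 H0 H4) as [_ H'].
  split; [eapply Rle_trans; [|exact H] | eapply Rle_trans; [exact H'|]];
    apply Req_le; unfold sin_approx, sin_term; cbn [Nat.mul Nat.add sum_f_R0];
    eval_factorials; field.
Qed.

Lemma cos_taylor_bounds a : -2 <= a <= 2 ->
  1 - a ^ 2 / 2 + a ^ 4 / 24 - a ^ 6 / 720 + a ^ 8 / 40320
    - a ^ 10 / 3628800 + a ^ 12 / 479001600 - a ^ 14 / 87178291200
  <= cos a <=
  1 - a ^ 2 / 2 + a ^ 4 / 24 - a ^ 6 / 720 + a ^ 8 / 40320
    - a ^ 10 / 3628800 + a ^ 12 / 479001600 - a ^ 14 / 87178291200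
    + a ^ 16 / 20922789888000.
Proof.
  intros [H0 H4].
  destruct (pre_cos_bound a 3 H0 H4) as [H H'].
  split; [eapply Rle_trans; [|exact H] | eapply Rle_trans; [exact H'|]];
    apply Req_le; unfold cos_approx, cos_term; cbn [Nat.mul Nat.add sum_f_R0];
    eval_factorials; field.
Qed.

Lemma PI_gt_3 : 3 < PI.
Proof. pose proof PI2_3_2; lra. Qed.

(** If PI exceeded 3.2 then cos 1.6 would be positive, against its upper Taylor
    polynomial. *)
Lemma PI_le_3_2 : PI <= 3.2.
Proof.
  destruct (Rle_lt_dec PI 3.2) as [|H]; [assumption|exfalso].
  assert (Hc : 0 < cos 1.6) by (apply cos_gt_0; lra).
  destruct (cos_taylor_bounds 1.6) as [_ H']; lra.
Qed.

(** * Enclosures at 2.83982 and 2.83983 *)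

Lemma Rlt_div_intro a b c : 0 < c -> a * c < b -> a < b / c.
Proof. intros Hc; apply (Rlt_div_r a b c Hc). Qed.

Lemma Rdiv_lt_intro a b c : 0 < c -> a < b * c -> a / c < b.
Proof. intros Hc; apply (Rlt_div_l a b c Hc). Qed.

Lemma Rmult_bounds a x b c y d :
  a <= x <= b -> c <= y <= d -> 0 <= a -> 0 <= c -> a * c <= x * y <= b * d.
Proof. intros; split; apply Rmult_le_compat; lra. Qed.

(** The half angle keeps the argument of the cosine inside [-2, 2], where its
    Taylor polynomials are known to enclose it, and makes the remainder at
    degree 15 smaller than 1e-9. *)
Lemma trig_left :
  0.297213221 <= sin 2.83982 <= 0.297213223 /\
  -0.954811136 <= cos 2.83982 <= -0.954811132.
Proof.
  replace 2.83982 with (2 * 1.41991) by lra.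
  rewrite sin_2a, cos_2a_sin.
  destruct (sin_taylor_bounds 1.41991) as [s1 s2]; [lra|].
  destruct (cos_taylor_bounds 1.41991) as [c1 c2]; [lra|].
  assert (Hs : 0.9886382384 <= sin 1.41991 <= 0.9886382388) by lra.
  assert (Hc : 0.1503144477 <= cos 1.41991 <= 0.1503144482) by lra.
  pose proof (Rmult_bounds _ _ _ _ _ _ Hs Hc ltac:(lra) ltac:(lra)).
  pose proof (Rmult_bounds _ _ _ _ _ _ Hs Hs ltac:(lra) ltac:(lra)).
  lra.
Qed.

Lemma trig_right :
  0.297203672 <= sin 2.83983 <= 0.297203676 /\
  -0.954814108 <= cos 2.83983 <= -0.954814103.
Proof.
  replace 2.83983 with (2 * 1.419915) by lra.
  rewrite sin_2a, cos_2a_sin.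
  destruct (sin_taylor_bounds 1.419915) as [s1 s2]; [lra|].
  destruct (cos_taylor_bounds 1.419915) as [c1 c2]; [lra|].
  assert (Hs : 0.9886389897 <= sin 1.419915 <= 0.9886389905) by lra.
  assert (Hc : 0.1503095045 <= cos 1.419915 <= 0.1503095050) by lra.
  pose proof (Rmult_bounds _ _ _ _ _ _ Hs Hc ltac:(lra) ltac:(lra)).
  pose proof (Rmult_bounds _ _ _ _ _ _ Hs Hs ltac:(lra) ltac:(lra)).
  lra.
Qed.

(** * The critical equation *)

Definition den (c : R) : R := 4 * c ^ 2 + 22 * c + 19.

Definition gap (t : R) : R :=
  (30 * sin t + 15 * cos t * sin t) / den (cos t) - t.

Lemma sin_sq_cos t : sin t * sin t = 1 - cos t * cos t.
Proof. generalize (sin2 t); unfold Rsqr; lra. Qed.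

Lemma den_pos c : -1 <= c -> 0 < den c.
Proof. unfold den; nra. Qed.

Lemma den_cos_pos t : 0 < den (cos t).
Proof. apply den_pos, COS_bound. Qed.

(** The numerator of the derivative is a quartic in cos t with a triple root at
    cos t = 1: gap vanishes to order 7 at 0. *)
Lemma gap_derive t :
  derivable_pt_lim gap t (2 * (1 - cos t) ^ 3 * (8 * cos t + 7) / den (cos t) ^ 2).
Proof.
  apply is_derive_Reals. pose proof (den_cos_pos t) as Hd.
  unfold gap, den in *. auto_derive; [lra|].
  match goal with |- ?l = ?r => enough (l - r = 0) by lra end.
  (* The two sides agree modulo sin^2 + cos^2 = 1; this is the multiple of that
     relation by which they differ. *)
  transitivity ((sin t * sin t - (1 - cos t * cos t)) * 15 *
    ((2 + cos t) * (8 * cos t + 22) - den (cos t)) / den (cos t) ^ 2);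
    unfold den; [field; lra | rewrite sin_sq_cos; field; lra].
Qed.

Lemma increasing_of_derive_pos g g' a b : a < b ->
  (forall t, a <= t <= b -> derivable_pt_lim g t (g' t)) ->
  (forall t, a < t < b -> 0 < g' t) -> g a < g b.
Proof.
  intros Hab Hd Hpos. destruct (MVT_cor2 g g' a b Hab Hd) as (c & He & Hc).
  specialize (Hpos c Hc). nra.
Qed.

Lemma decreasing_of_derive_neg g g' a b : a < b ->
  (forall t, a <= t <= b -> derivable_pt_lim g t (g' t)) ->
  (forall t, a < t < b -> g' t < 0) -> g b < g a.
Proof.
  intros Hab Hd Hneg. destruct (MVT_cor2 g g' a b Hab Hd) as (c & He & Hc).
  specialize (Hneg c Hc). nra.
Qed.

Lemma gap_0 : gap 0 = 0.
Proof. unfold gap. rewrite sin_0. unfold Rdiv. ring. Qed.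

Lemma gap_pos_of_cos_ge t : 0 < t <= PI -> -7 / 8 <= cos t -> 0 < gap t.
Proof.
  intros Ht Hc. rewrite <- gap_0.
  eapply increasing_of_derive_pos; [lra| intros; apply gap_derive|].
  intros u Hu. pose proof (den_cos_pos u).
  assert (cos t < cos u) by (apply cos_decreasing_1; lra).
  assert (cos u < 1) by (rewrite <- cos_0; apply cos_decreasing_1; lra).
  apply Rdiv_lt_0_compat; [|apply pow_lt; lra].
  apply Rmult_lt_0_compat; [|lra].
  apply Rmult_lt_0_compat; [lra|apply pow_lt; lra].
Qed.

Lemma gap_decreasing s t : 0 <= s -> s < t -> t <= PI -> cos s <= -7 / 8 ->
  gap t < gap s.
Proof.
  intros Hs Hst Ht Hc.
  eapply decreasing_of_derive_neg; [lra| intros; apply gap_derive|].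
  intros u Hu. pose proof (den_cos_pos u).
  assert (cos u < cos s) by (apply cos_decreasing_1; lra).
  cbv beta.
  enough (0 < 2 * (1 - cos u) ^ 3 * (- (8 * cos u + 7)) / den (cos u) ^ 2)
    by (unfold Rdiv in *; nra).
  apply Rdiv_lt_0_compat; [|apply pow_lt; lra].
  apply Rmult_lt_0_compat; [|lra].
  apply Rmult_lt_0_compat; [lra|apply pow_lt; lra].
Qed.

(** As long as cos t >= -7/8, gap has only increased from gap 0 = 0; so a zero in
    (0, PI) lies strictly inside the region where gap decreases. *)
Lemma gap_sign t0 : 0 < t0 < PI -> gap t0 = 0 ->
  (forall t, 0 < t < t0 -> 0 < gap t) /\ (forall t, t0 < t <= PI -> gap t < 0).
Proof.
  intros Ht0 H0.
  assert (Hc0 : cos t0 < -7 / 8).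
  { apply Rnot_le_lt; intros Hc.
    pose proof (gap_pos_of_cos_ge t0 ltac:(lra) Hc); lra. }
  split; intros t Ht.
  - destruct (Rle_lt_dec (-7 / 8) (cos t)) as [Hc|Hc].
    + apply gap_pos_of_cos_ge; lra.
    + rewrite <- H0. apply gap_decreasing; lra.
  - rewrite <- H0. apply gap_decreasing; lra.
Qed.

Lemma t0_equation_gap t : t0_equation t <-> gap t = 0.
Proof. unfold t0_equation, gap, den. lra. Qed.

(** * The lower inequality *)

(** With z = y^2 and p = 1 - z/6 + z^2/130, the Taylor polynomial of degree 7
    gives sin y >= y p on the range z < 2.56 = 1.6^2, and the claim reduces to
    p^2 (3 + 2z) > 3 there. *)
Lemma sin_sq_lower y : 0 < y < PI / 2 ->
  3 * y ^ 2 < sin y ^ 2 * (3 + 2 * y ^ 2).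
Proof.
  intros Hy. pose proof PI_le_3_2.
  pose proof (sin_ge_taylor7 y ltac:(lra)) as Hs.
  set (z := y ^ 2) in *.
  assert (Hz : 0 < z < 2.56) by (unfold z; nra).
  (* 1/130 absorbs the cubic term: 1/120 - 2.56/5040 > 1/130. *)
  set (q := 1 - z / 6 + z ^ 2 / 120 - z ^ 3 / 5040) in *.
  assert (Hq : 1 - z / 6 + z ^ 2 / 130 <= q) by (unfold q; nra).
  set (p := 1 - z / 6 + z ^ 2 / 130) in *.
  assert (Hp : 0 < p) by (unfold p; nra).
  assert (Hsq : z * p ^ 2 <= sin y ^ 2).
  { replace (z * p ^ 2) with ((y * p) ^ 2) by (unfold z; ring).
    apply pow_incr; split; [apply Rmult_le_pos; lra|].
    eapply Rle_trans; [|exact Hs]. apply Rmult_le_compat_l; lra. }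
  assert (Hpoly : 3 < p ^ 2 * (3 + 2 * z)).
  { (* z times this cubic is a lower bound for p^2 (3 + 2z) - 3: its coefficients
       are those of the exact quotient by z, rounded down. *)
    assert (Hr : 0 < 1 - 0.538 * z + 0.078 * z ^ 2 - 0.005 * z ^ 3) by nra.
    pose proof (Rmult_lt_0_compat _ _ (proj1 Hz) Hr).
    pose proof (fun n => pow_lt z n (proj1 Hz)) as Hpow.
    pose proof (Hpow 2%nat); pose proof (Hpow 3%nat);
    pose proof (Hpow 4%nat); pose proof (Hpow 5%nat).
    unfold p. lra. }
  nra.
Qed.

(** Substituting cos x = 1 - 2 (sin (x/2))^2 turns this into [sin_sq_lower]. *)
Lemma quadratic_lower x : 0 < x < PI ->
  x ^ 2 / 6 < (1 - cos x) / (2 + cos x).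
Proof.
  intros Hx. pose proof (sin_sq_lower (x / 2) ltac:(lra)) as H.
  replace (cos x) with (1 - 2 * sin (x / 2) * sin (x / 2))
    by (rewrite <- cos_2a_sin; f_equal; field).
  set (S := sin (x / 2)) in *.
  assert (HS : 2 * S * S < 3).
  { pose proof (SIN_bound (x / 2)). fold S in H0. nra. }
  apply Rlt_div_intro; [lra|]. nra.
Qed.

(** With r = (1 - cos t)/(2 + cos t), the derivative of t - 3 sin t/(2 + cos t)
    is r^2, so the derivative of the difference of the two sides is
    r^2 - (t^2/6)^2. *)
Lemma quintic_lower x : 0 < x <= PI ->
  1 / 180 * x ^ 5 < x - 3 * sin x / (2 + cos x).
Proof.
  intros Hx.
  set (g t := t - 3 * sin t / (2 + cos t) - t ^ 5 / 180).
  enough (g 0 < g x).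
  { unfold g in H. rewrite sin_0 in H. lra. }
  apply increasing_of_derive_pos with
    (fun t => ((1 - cos t) / (2 + cos t) - t ^ 2 / 6)
            * ((1 - cos t) / (2 + cos t) + t ^ 2 / 6)); [lra| |].
  - intros t Ht. apply is_derive_Reals. pose proof (COS_bound t). unfold g.
    auto_derive; [lra|].
    match goal with |- ?l = ?r => enough (l - r = 0) by lra end.
    transitivity (-3 * (sin t * sin t - (1 - cos t * cos t)) / (2 + cos t) ^ 2);
      [field; lra | rewrite sin_sq_cos; field; lra].
  - intros t Ht. pose proof (quadratic_lower t ltac:(lra)). cbv beta.
    apply Rmult_lt_0_compat; [lra|nra].
Qed.

(** * The maximum of the quotient *)

Lemma fq_derive t : 0 < t ->
  derivable_pt_lim fq t (gap t * (den (cos t) / ((2 + cos t) ^ 2 * t ^ 6))).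
Proof.
  intros Ht. apply is_derive_Reals. pose proof (den_cos_pos t) as Hd.
  pose proof (COS_bound t).
  unfold fq, gap, den in *.
  assert (t ^ 5 <> 0) by (apply pow_nonzero; lra).
  auto_derive; [repeat split; lra|].
  match goal with |- ?l = ?r => enough (l - r = 0) by lra end.
  (* Again the difference is a multiple of sin^2 + cos^2 - 1. *)
  transitivity
    (-3 * (sin t * sin t - (1 - cos t * cos t)) / ((2 + cos t) ^ 2 * t ^ 5));
    [field; repeat split; lra | rewrite sin_sq_cos; field; repeat split; lra].
Qed.

Lemma fq_derive_factor_pos t : 0 < t ->
  0 < den (cos t) / ((2 + cos t) ^ 2 * t ^ 6).
Proof.
  intros Ht. pose proof (COS_bound t).
  apply Rdiv_lt_0_compat; [apply den_cos_pos|].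
  apply Rmult_lt_0_compat; apply pow_lt; lra.
Qed.

Lemma fq_max t0 : 0 < t0 < PI -> gap t0 = 0 ->
  forall x, 0 < x <= PI -> fq x <= fq t0.
Proof.
  intros Ht0 H0 x Hx. destruct (gap_sign t0 Ht0 H0) as [Hl Hr].
  destruct (Rtotal_order x t0) as [H|[->|H]]; [|lra|]; apply Rlt_le.
  - eapply increasing_of_derive_pos; [exact H| intros; apply fq_derive; lra|].
    intros t Ht. apply Rmult_lt_0_compat; [apply Hl; lra|].
    apply fq_derive_factor_pos; lra.
  - eapply decreasing_of_derive_neg; [exact H| intros; apply fq_derive; lra|].
    intros t Ht. pose proof (Hr t ltac:(lra)).
    pose proof (fq_derive_factor_pos t ltac:(lra)). cbv beta. nra.
Qed.

(** * Locating the maximum *)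

Lemma gap_left : 0 < gap 2.83982 < 1 / 10000.
Proof.
  destruct trig_left as [Hs Hc]. unfold gap.
  set (s := sin 2.83982) in *. set (c := cos 2.83982) in *.
  assert (Hd : 0 < den c) by (apply den_pos; lra).
  split.
  - enough (2.83982 < (30 * s + 15 * c * s) / den c) by lra.
    apply Rlt_div_intro; [assumption|]. unfold den. nra.
  - enough ((30 * s + 15 * c * s) / den c < 2.83982 + 1/10000) by lra.
    apply Rdiv_lt_intro; [assumption|]. unfold den. nra.
Qed.

Lemma gap_right : gap 2.83983 < 0.
Proof.
  destruct trig_right as [Hs Hc]. unfold gap.
  set (s := sin 2.83983) in *. set (c := cos 2.83983) in *.
  assert (Hd : 0 < den c) by (apply den_pos; lra).
  enough ((30 * s + 15 * c * s) / den c < 2.83983) by lra.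
  apply Rdiv_lt_intro; [assumption|]. unfold den. nra.
Qed.

(** The margin of 6e-10 in the upper bound covers the growth of f, less than
    1e-10, between 2.83982 and t0. *)
Lemma fq_left : 1 / 92.96407 < fq 2.83982 < 1 / 92.96406 - 6 / 10 ^ 10.
Proof.
  destruct trig_left as [Hs Hc]. unfold fq.
  set (s := sin 2.83982) in *. set (c := cos 2.83982) in *.
  assert (Hg : 0.853089513 < 3 * s / (2 + c) < 0.853089523).
  { split; [apply Rlt_div_intro; [lra|]
           |apply Rdiv_lt_intro; [lra|]]; lra. }
  split; [apply Rlt_div_intro; [lra|]
         |apply Rdiv_lt_intro; [lra|]]; lra.
Qed.

(** Interval evaluation on [2.83982, 2.83983] is too coarse to give seven digits
    of m1.  The mean value theorem makes the error quadratic in the width: f' is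
    small near its zero t0, because gap stays below its value at 2.83982 and its
    cofactor in f' is less than 1/10. *)
Lemma fq_growth t : 2.83982 < t <= PI ->
  fq t < fq 2.83982 + (t - 2.83982) / 10 ^ 5.
Proof.
  intros Ht. destruct trig_left as [_ Hc]. destruct gap_left as [_ Hg].
  destruct (MVT_cor2 fq (fun t => gap t * (den (cos t) / ((2 + cos t) ^ 2 * t ^ 6)))
    2.83982 t) as (u & He & Hu); [lra| intros; apply fq_derive; lra|].
  assert (Hgu : gap u < gap 2.83982) by (apply gap_decreasing; lra).
  assert (Hcu : cos u < cos 2.83982) by (apply cos_decreasing_1; lra).
  pose proof (COS_bound u) as [Hcu' _].
  pose proof (fq_derive_factor_pos u ltac:(lra)) as Hf.
  set (k := den (cos u) / ((2 + cos u) ^ 2 * u ^ 6)) in *.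
  assert (Hk : k < 1 / 10).
  { unfold k.
    assert (H1 : 1 <= (2 + cos u) ^ 2) by nra.
    assert (H2 : 2 ^ 6 <= u ^ 6) by (apply pow_incr; lra).
    apply Rdiv_lt_intro; [nra|].
    unfold den. nra. }
  assert (gap u * k < 1 / 10 ^ 5) by nra.
  nra.
Qed.

Theorem theorem4 :
  exists t0 : R,
    unique (fun t : R => 0 < t < PI /\ t0_equation t) t0 /\
    2.83982 <= t0 < 2.83983 /\
    let m1 := 1 / fq t0 in
    92.96406 <= m1 < 92.96407 /\
    forall x : R, 0 < x <= PI ->
      1 / 180 * x ^ 5 < x - 3 * sin x / (2 + cos x) <= 1 / m1 * x ^ 5.
Proof.
  pose proof PI_gt_3 as Hpi.
  destruct (IVT_cor gap 2.83982 2.83983) as (t0 & Ht0 & Hz).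
  { apply derivable_continuous; intros t; eexists; apply gap_derive. }
  { lra. }
  { pose proof gap_left; pose proof gap_right; nra. }
  assert (Hlt : 2.83982 < t0 < 2.83983).
  { pose proof gap_left; pose proof gap_right.
    split; apply Rnot_le_lt; intros Hle.
    - replace t0 with 2.83982 in Hz; lra.
    - replace t0 with 2.83983 in Hz; lra. }
  assert (Ht : 0 < t0 < PI) by lra.
  destruct (gap_sign t0 Ht Hz) as [Hl Hr].
  exists t0; split; [|split; [lra|]].
  { split; [split; [lra|now apply t0_equation_gap]|].
    intros t [Hti He]. apply t0_equation_gap in He.
    destruct (Rtotal_order t t0) as [H|[H|H]]; [|easy|].
    - specialize (Hl t ltac:(lra)); lra.
    - specialize (Hr t ltac:(lra)); lra. }
  pose proof (fq_max t0 Ht Hz) as Hmax.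
  pose proof (Hmax 2.83982 ltac:(lra)) as Hlow.
  pose proof (fq_growth t0 ltac:(lra)) as Hup.
  destruct fq_left as [Hf1 Hf2].
  assert (Hb : 1 / 92.96407 < fq t0 < 1 / 92.96406) by lra.
  cbv zeta. split.
  { split; [apply Rlt_le, Rlt_div_intro|apply Rdiv_lt_intro]; lra. }
  intros x Hx; split; [now apply quintic_lower|].
  replace (1 / (1 / fq t0)) with (fq t0) by (field; lra).
  assert (Hx5 : 0 < x ^ 5) by (apply pow_lt; lra).
  apply Rle_div_l; [assumption|]. apply (Hmax x Hx).
Qed.
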